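(* Let $\mu=(0,1,\dots,n-1)\in\mathbb Z^n$ and let $\lambda=(\lambda_1,\dots,\lambda_n)$ be a partition with $\lambda_1=m$ and $\lambda_n\ge n$. Then the $m$ polynomials $$\sum_{i\ge1,\ i\le n,\ k+i\le\lambda_i}x_ix_{k+i},\qquad k=0,\dots,m-1,$$ (the diagonals of the tableau $\mathbf T_{\lambda-\mu}$, each summand a monomial generator of $\overline I_{\lambda-\mu}$) generate a minimal reduction $\overline J_{\lambda-\mu}$ of the specialized Ferrers ideal $\overline I_{\lambda-\mu}$.
   Context: Let $K$ be a field. The specialized Ferrers ideal is $\overline I_{\lambda-\mu}=(x_ix_j:1\le i\le n,\ \mu_i<j\le\lambda_i)\subset K[x_1,\dots,x_m]$; for $\mu=(0,1,\dots,n-1)$ this is $(x_ix_j:1\le i\le n,\ i\le j\le\lambda_i)$. An ideal $J\subset I$ is a reduction of $I$ if $I^{r+1}=JI^r$ for some $r\ge0$; it is a minimal reduction if no ideal strictly contained in $J$ is a reduction of $I$. *)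

(* Defs.v *)
From HB Require Import structures.
From mathcomp Require Import all_boot all_order all_algebra.
Set Implicit Arguments. Unset Strict Implicit. Unset Printing Implicit Defensive.
Import Order.TTheory GRing.Theory Num.Theory.
Local Open Scope ring_scope.

(* The polynomial ring R[y_0,...,y_{m-1}] built as iterated univariate
   polynomial rings: polyring R 0 = R, polyring R (m+1) = (polyring R m)[y_m]. *)
Fixpoint polyring (R : comNzRingType) (m : nat) : comNzRingType :=
  match m with
  | 0 => R
  | m'.+1 => ({poly polyring R m'} : comNzRingType)
  end.

(* var m i = the variable y_i of polyring R m (i < m); 0 if i >= m. *)
Fixpoint var (R : comNzRingType) (m i : nat) : polyring R m :=
  match m return polyring R m with
  | 0 => 0
  | m'.+1 => if i == m' then ('X : {poly polyring R m'})
             else ((var R m' i)%:P : {poly polyring R m'})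
  end.

(* x_i, 1 <= i <= m, in K[x_1,...,x_m]. *)
Arguments var R m i : clear implicits.
Definition xvar (R : comNzRingType) (m i : nat) : polyring R m := var R m i.-1.

Section Ideals.
Variable R : comNzRingType.

Definition is_ideal (I : R -> Prop) : Prop :=
  [/\ I 0, (forall a b, I a -> I b -> I (a + b)) & (forall r a, I a -> I (r * a))].

Definition ideal_gen (S : R -> Prop) : R -> Prop :=
  fun x => exists (k : nat) (c g : 'I_k -> R),
    (forall i, S (g i)) /\ x = \sum_(i < k) c i * g i.

Definition ideal_mul (I J : R -> Prop) : R -> Prop :=
  ideal_gen (fun x => exists a b, [/\ I a, J b & x = a * b]).

Fixpoint ideal_pow (I : R -> Prop) (r : nat) : R -> Prop :=
  match r with
  | 0 => ideal_gen (fun x => x = 1)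
  | r'.+1 => ideal_mul I (ideal_pow I r')
  end.

Definition ideal_sub (I J : R -> Prop) : Prop := forall x, I x -> J x.

Definition is_reduction (J I : R -> Prop) : Prop :=
  [/\ is_ideal J, ideal_sub J I &
      exists r : nat, forall x, ideal_pow I r.+1 x <-> ideal_mul J (ideal_pow I r) x].

Definition is_minimal_reduction (J I : R -> Prop) : Prop :=
  is_reduction J I /\
  forall J', is_ideal J' -> ideal_sub J' J -> ~ ideal_sub J J' -> ~ is_reduction J' I.

End Ideals.

(* Specialized Ferrers ideal for mu = (0,1,...,n-1) in K[x_1..x_m]:
   generated by x_i x_j, 1 <= i <= n, i <= j <= lam i. *)
Definition ferrers_spec (K : fieldType) (m n : nat) (lam : nat -> nat)
  : polyring K m -> Prop :=
  ideal_gen (fun p => exists i j : nat,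
    [/\ (1 <= i <= n)%N, (i <= j <= lam i)%N & p = xvar K m i * xvar K m j]).

Definition ferrers_diag (K : fieldType) (m n : nat) (lam : nat -> nat) (k : nat)
  : polyring K m :=
  \sum_(1 <= i < n.+1 | (k + i <= lam i)%N) xvar K m i * xvar K m (k + i).

Definition ferrers_diag_ideal (K : fieldType) (m n : nat) (lam : nat -> nat)
  : polyring K m -> Prop :=
  ideal_gen (fun p => exists k : nat, (k < m)%N /\ p = ferrers_diag K m n lam k).

Arguments ferrers_spec K m n lam : clear implicits.
Arguments ferrers_diag K m n lam k : clear implicits.
Arguments ferrers_diag_ideal K m n lam : clear implicits.

(* Main.v *)
Require Import Defs.
From HB Require Import structures.
From mathcomp Require Import all_boot all_order all_algebra.
From mathcomp Require Import boolp classical_sets generic_quotient ring_quotient.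
From mathcomp Require Import zify ring.
Set Implicit Arguments. Unset Strict Implicit. Unset Printing Implicit Defensive.
Import GRing.Theory.
Local Open Scope ring_scope.

(** Reduction: in the Rees ring of [I] modulo [J], every generator [x_i x_j] is nilpotent. Going
    down the diagonals, two distinct entries of diagonal [k] multiply to an entry of a
    diagonal further out times an element of [I], so multiplying the [k]-th diagonal sum by one of its entries
    shows that the square of this entry is nilpotent. The pigeonhole principle then gives
    [I^(r+1) = J I^r] for large [r].

    Minimality: let [J'] inside [J] be a reduction of [I] with [J' <> J]. The ideal [J' : J] is
    proper, hence killed by a morphism [psi] to a field [L]; [J'] contains a power of [I], so [psi]
    kills [x_1, ..., x_n]. Since [J'] need not be homogeneous, this point of the spectrum need not
    be the origin. Let [s] be the number of rows containing some [x_j] with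
    [psi x_j <> 0] and [l = lam_(s+1)] ([l = n] if [s = n]). Then [J] is contained in the ideal
    generated by the [l] elements [x_1, ..., x_s] and the first [l - s] diagonals. If [J'] spans
    these generators modulo the kernel of [psi], Cramer's rule yields an element of [J' : J] not
    killed by [psi]. Otherwise the leading forms of [J'] along a curve through the point, with
    weights 2, 1, 0 on [x_1..x_s], [x_(s+1)..x_l] and the rest, lie in the span of fewer than [l]
    elements, so those of [I^d] grow like [d^(l-2)]; but they contain the monomials in [l]
    algebraically independent elements, which grow like [d^(l-1)]. *)

(** * Ideals, powers and reductions *)

Section IdealTheory.
Variable R : comNzRingType.
Implicit Types (I J : R -> Prop) (S : R -> Prop).

Lemma is_ideal_sum I (T : Type) (s : seq T) (P : pred T) (F : T -> R) :
  is_ideal I -> (forall i, P i -> I (F i)) -> I (\sum_(i <- s | P i) F i).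
Proof. by case=> h0 hD _ hF; apply: big_ind. Qed.

Lemma is_ideal_mulr I b : is_ideal I -> is_ideal (fun a => I (a * b)).
Proof.
case=> h0 hD hM; split=> [|x y hx hy|r x hx]; first by rewrite mul0r.
  by rewrite mulrDl; apply: hD.
by rewrite -mulrA; apply: hM.
Qed.

Lemma ideal_gen_ideal S : is_ideal (ideal_gen S).
Proof.
split.
- by exists 0%N, (fun=> 0), (fun=> 0); split=> [[]|] //; rewrite big_ord0.
- move=> _ _ [k [c [g [hg ->]]]] [k' [c' [g' [hg' ->]]]].
  exists (k + k')%N, (fun i => match split i with inl j => c j | inr j => c' j end),
    (fun i => match split i with inl j => g j | inr j => g' j end); split.
    by move=> i; case: (split i).
  rewrite big_split_ord /=; congr (_ + _); apply: eq_bigr => i _.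
    by rewrite (unsplitK (inl i)).
  by rewrite (unsplitK (inr i)).
move=> r _ [k [c [g [hg ->]]]]; exists k, (fun i => r * c i), g; split=> //.
by rewrite mulr_sumr; apply: eq_bigr => i _; rewrite mulrA.
Qed.

Lemma ideal_mul_ideal I J : is_ideal (ideal_mul I J).
Proof. exact: ideal_gen_ideal. Qed.

Lemma mem_ideal_gen S x : S x -> ideal_gen S x.
Proof. by exists 1%N, (fun=> 1), (fun=> x); split=> //; rewrite big_ord1 mul1r. Qed.

Lemma ideal_gen_min S I : is_ideal I -> (forall x, S x -> I x) ->
  ideal_sub (ideal_gen S) I.
Proof.
move=> idI sSI _ [k [c [g [hg ->]]]]; apply: is_ideal_sum => // i _.
by case: idI => _ _; apply; apply: sSI.
Qed.

Lemma ideal_mul_mem I J a b : I a -> J b -> ideal_mul I J (a * b).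
Proof. by move=> ha hb; apply: mem_ideal_gen; exists a, b. Qed.

Lemma ideal_mulS I I' J J' : ideal_sub I I' -> ideal_sub J J' ->
  ideal_sub (ideal_mul I J) (ideal_mul I' J').
Proof.
move=> sI sJ; apply: ideal_gen_min; first exact: ideal_gen_ideal.
by move=> _ [a [b [ha hb ->]]]; apply: ideal_mul_mem; [apply: sI|apply: sJ].
Qed.

Lemma ideal_mul_subl I J : is_ideal I -> ideal_sub (ideal_mul I J) I.
Proof.
move=> idI; apply: ideal_gen_min => // _ [a [b [ha hb ->]]].
by rewrite mulrC; case: idI => _ _; apply.
Qed.

Lemma ideal_pow_ideal I r : is_ideal (ideal_pow I r).
Proof. by case: r => [|r]; apply: ideal_gen_ideal. Qed.

Lemma ideal_pow0 I x : ideal_pow I 0 x.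
Proof.
by rewrite -[x]mulr1; case: (ideal_pow_ideal I 0) => _ _; apply; apply: mem_ideal_gen.
Qed.

Lemma ideal_pow1 I x : I x -> ideal_pow I 1 x.
Proof. by move=> hx; rewrite -[x]mulr1; apply: ideal_mul_mem hx (ideal_pow0 _ _). Qed.

Lemma ideal_powD I r s a b : ideal_pow I r a -> ideal_pow I s b ->
  ideal_pow I (r + s) (a * b).
Proof.
move=> + hb; elim: r a => [a _|r IH].
  by case: (ideal_pow_ideal I s) => _ _; apply.
suff : ideal_sub (ideal_pow I r.+1) (fun a => ideal_pow I (r.+1 + s) (a * b)) by [].
apply: ideal_gen_min; first exact/is_ideal_mulr/ideal_pow_ideal.
by move=> _ [x [y [hx hy ->]]]; rewrite -mulrA; apply: ideal_mul_mem => //; apply: IH.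
Qed.

Lemma ideal_powX I r a k : ideal_pow I r a -> ideal_pow I (k * r) (a ^+ k).
Proof.
move=> ha; elim: k => [|k IH]; first exact: ideal_pow0.
by rewrite mulSn exprS; apply: ideal_powD.
Qed.

Lemma ideal_pow_min (I : R -> Prop) r (A : R -> Prop) : is_ideal A ->
  (forall a b, I a -> ideal_pow I r b -> A (a * b)) -> ideal_sub (ideal_pow I r.+1) A.
Proof. by move=> idA h; apply: ideal_gen_min => // _ [a [b [ha hb ->]]]; apply: h. Qed.

Lemma ideal_mul_pow J I r s a b : ideal_mul J (ideal_pow I r) a -> ideal_pow I s b ->
  ideal_mul J (ideal_pow I (r + s)) (a * b).
Proof.
move=> + hb; suff : ideal_sub (ideal_mul J (ideal_pow I r))
   (fun a => ideal_mul J (ideal_pow I (r + s)) (a * b)) by move=> h /h.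
apply: ideal_gen_min; first exact/is_ideal_mulr/ideal_gen_ideal.
move=> _ [x [y [hx hy ->]]]; rewrite -mulrA; apply: ideal_mul_mem => //.
exact: ideal_powD.
Qed.

(** Multiplying the inclusion at [r] by one more factor from [I] gives the inclusion at [r + 1]; the
    growth argument iterates this. *)
Lemma reduction_pow J I r : ideal_sub (ideal_pow I r.+1) (ideal_mul J (ideal_pow I r)) ->
  forall d, ideal_sub (ideal_pow I (r + d).+1) (ideal_mul J (ideal_pow I (r + d))).
Proof.
move=> hr; elim=> [|d IH]; first by rewrite addn0.
rewrite addnS; apply: ideal_pow_min; first exact: ideal_gen_ideal.
move=> a b ha /IH hb; rewrite mulrC -addn1.
exact: ideal_mul_pow hb (ideal_pow1 ha).
Qed.

(** Indexing products by tuples serves two counts: the pigeonhole on repeated generators, and the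
    bound [#|T| ^ r] on generators of the [r]-th power. *)
Lemma ideal_pow_gen (T : finType) (g : T -> R) S r :
    (forall x, S x -> exists i, x = g i) ->
  ideal_sub (ideal_pow (ideal_gen S) r)
    (ideal_gen (fun x => exists t : r.-tuple T, x = \prod_(i <- t) g i)).
Proof.
move=> hS; elim: r => [|r IH].
  apply: ideal_gen_min; first exact: ideal_gen_ideal.
  by move=> _ ->; apply: mem_ideal_gen; exists [tuple]; rewrite big_nil.
set A := (X in ideal_sub _ X); have idA : is_ideal A by apply: ideal_gen_ideal.
apply: (ideal_pow_min idA) => a b ha /IH; rewrite mulrC.
apply: (ideal_gen_min (I := fun b => A (b * a))); first exact: is_ideal_mulr.
move=> _ [t ->]; rewrite mulrC; move: ha.
apply: (ideal_gen_min (I := fun a => A (a * _))); first exact: is_ideal_mulr.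
move=> x /hS[i ->]; apply: mem_ideal_gen; exists [tuple of i :: t].
by rewrite /= big_cons.
Qed.

(* [f] of degree [d] in the Rees ring of [I] is nilpotent modulo [J]. *)
Definition rees_nil J I d f :=
  ideal_pow I d.+1 f /\
  exists N, ideal_mul J (ideal_pow I (N.+1 * d.+1).-1) (f ^+ N.+1).

(** Since [f] lies in [I^(d+1)], its [k]-th power has Rees degree [k * d.+1]; the predecessor in the
    exponent accounts for the one factor taken from [J]. *)
Lemma rees_nil_ge J I d f N : ideal_pow I d.+1 f ->
  ideal_mul J (ideal_pow I (N.+1 * d.+1).-1) (f ^+ N.+1) ->
  forall k, (N < k)%N -> ideal_mul J (ideal_pow I (k * d.+1).-1) (f ^+ k).
Proof.
move=> hf hN k hk; rewrite -(subnKC hk) exprD.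
have -> : ((N.+1 + (k - N.+1)) * d.+1).-1 = ((N.+1 * d.+1).-1 + (k - N.+1) * d.+1)%N.
  by rewrite mulnDl /=; lia.
exact: ideal_mul_pow hN (ideal_powX _ hf).
Qed.

(** In the binomial expansion of the power [N + N' + 1], each term has either more than [N'] factors
    [g] or more than [N] factors [f]. *)
Lemma rees_nilD J I d f g : rees_nil J I d f -> rees_nil J I d g ->
  rees_nil J I d (f + g).
Proof.
move=> [hf [N hN]] [hg [N' hN']]; split.
  by case: (ideal_pow_ideal I d.+1) => _ + _; apply.
exists (N + N')%N; rewrite exprDn; apply: is_ideal_sum; first exact: ideal_gen_ideal.
move=> i _; rewrite -mulr_natl.
case: (ideal_mul_ideal J (ideal_pow I (((N + N').+1 * d.+1).-1))) => _ _; apply.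
move: (nat_of_ord i) (ltn_ord i) => {}i hi.
have [hiN|hiN] := ltnP N' i.
  have -> : ((N + N').+1 * d.+1).-1 = ((i * d.+1).-1 + ((N + N').+1 - i) * d.+1)%N.
    have : (0 < i * d.+1)%N by rewrite muln_gt0; lia.
    have <- : (i + ((N + N').+1 - i) = (N + N').+1)%N by lia.
    by rewrite mulnDl; lia.
  rewrite mulrC; apply: ideal_mul_pow (ideal_powX _ hf).
  exact: rees_nil_ge hN' _ _.
have h2 : (N < (N + N').+1 - i)%N by lia.
have -> : ((N + N').+1 * d.+1).-1 = ((((N + N').+1 - i) * d.+1).-1 + i * d.+1)%N.
  have : (0 < ((N + N').+1 - i) * d.+1)%N by rewrite muln_gt0; lia.
  have {2}<- : (i + ((N + N').+1 - i) = (N + N').+1)%N by lia.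
  by rewrite mulnDl; lia.
by apply: ideal_mul_pow (ideal_powX _ hg); apply: rees_nil_ge hN _ _.
Qed.

Lemma rees_nilM J I d e f g : rees_nil J I d f -> ideal_pow I e g ->
  rees_nil J I (d + e) (f * g).
Proof.
move=> [hf [N hN]] hg; split; first by rewrite -addSn; apply: ideal_powD.
exists N; rewrite exprMn.
have -> : (N.+1 * (d + e).+1).-1 = ((N.+1 * d.+1).-1 + N.+1 * e)%N by rewrite -addSn mulnDr /=; lia.
exact: ideal_mul_pow hN (ideal_powX _ hg).
Qed.

Lemma rees_nil_mul J I d f : ideal_sub J I -> ideal_mul J (ideal_pow I d) f -> rees_nil J I d f.
Proof.
move=> sJI hf; split; first by apply: ideal_mulS hf.
by exists 0%N; rewrite mul1n expr1.
Qed.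

Lemma rees_nil_sqr J I f : I f -> rees_nil J I 1 (f ^+ 2) -> rees_nil J I 0 f.
Proof.
move=> hf [_ [N hN]]; split; first exact: ideal_pow1.
exists (N.*2).+1; rewrite -exprM in hN.
have -> : ((N.*2).+2 = 2 * N.+1)%N by lia.
by rewrite muln1 {1}mulnC.
Qed.

Lemma rees_nilN J I d f : rees_nil J I d f -> rees_nil J I d (- f).
Proof. by move=> h; rewrite -mulN1r mulrC -[d]addn0; apply: rees_nilM => //; apply: ideal_pow0. Qed.

Lemma rees_nil_sum J I d (T : Type) (s : seq T) (P : pred T) (F : T -> R) : ideal_sub J I ->
  (forall i, P i -> rees_nil J I d (F i)) -> rees_nil J I d (\sum_(i <- s | P i) F i).
Proof.
move=> sJI hF; apply: big_ind => //; last by move=> x y; apply: rees_nilD.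
by apply: rees_nil_mul => //; case: (ideal_mul_ideal J (ideal_pow I d)).
Qed.

(** With a common exponent [N] for all generators, a product of [#|T| * N + 1] of them repeats some
    generator more than [N] times, and that power supplies the factor from [J]. *)
Lemma reduction_of_nil (T : finType) (g : T -> R) S J :
    (forall x, S x -> exists i, x = g i) -> (forall i, rees_nil J (ideal_gen S) 0 (g i)) ->
  exists r, ideal_sub (ideal_pow (ideal_gen S) r.+1) (ideal_mul J (ideal_pow (ideal_gen S) r)).
Proof.
set I := ideal_gen S => hS hg.
have gI i : ideal_pow I 1 (g i) by case: (hg i).
have [N hN] : exists N, forall i, ideal_mul J (ideal_pow I N) (g i ^+ N.+1).
  have /choice[b hb] : forall i, exists N, ideal_mul J (ideal_pow I (N.+1 * 1).-1) (g i ^+ N.+1).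
    by move=> i; case: (hg i).
  exists (\max_i b i) => i.
  have := rees_nil_ge (gI i) (hb i) (k := (\max_i b i).+1); rewrite muln1; apply.
  by rewrite ltnS leq_bigmax.
exists (#|T| * N)%N => x /(ideal_pow_gen hS); apply: ideal_gen_min; first exact: ideal_gen_ideal.
move=> _ [[t /= /eqP szt] ->].
have [i hi] : exists i, (N < count_mem i t)%N.
  apply: contrapT => /forallNP h.
  have : (\sum_i count_mem i t <= #|T| * N)%N.
    rewrite -sum_nat_const; apply: leq_sum => i _; rewrite leqNgt; exact/negP/h.
  have -> : (\sum_i count_mem i t = size t)%N.
    elim: {szt h} t => [|y s IH] /=; first by rewrite big1.
    rewrite big_split /= IH -add1n; congr addn.
    by rewrite (bigD1 y) //= eqxx big1 // => j /negPf; rewrite eq_sym => ->.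
  by rewrite szt ltnn.
(* Move all copies of the repeated generator to the front. *)
have hp : perm_eq (nseq (count_mem i t) i ++ [seq j <- t | j != i]) t.
  rewrite -[X in nseq X]size_filter.
  rewrite (_ : nseq _ i = [seq j <- t | j == i]); last first.
    by apply/esym/all_pred1P; rewrite filter_all.
  by rewrite perm_filterC.
rewrite -(perm_big _ hp) /= big_cat /= big_nseq iter_mulr_1.
have hprod (s : seq T) : ideal_pow I (size s) (\prod_(j <- s) g j).
  elim: s => [|j s IH]; first exact: ideal_pow0.
  by rewrite big_cons -[size _]/(1 + size s)%N; apply: ideal_powD.
have hsz : (count_mem i t + size [seq j <- t | j != i] = (#|T| * N).+1)%N.
  by rewrite -szt -(perm_size hp) size_cat size_nseq.
have -> : (#|T| * N = N + ((count_mem i t - N.+1) + size [seq j <- t | j != i]))%N by lia.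
rewrite -[X in g i ^+ X](subnKC hi) exprD -mulrA; apply: ideal_mul_pow (hN i) _.
apply: ideal_powD (hprod _).
by rewrite -[X in ideal_pow I X]muln1; apply: ideal_powX.
Qed.

End IdealTheory.

(** * The diagonals generate a reduction *)

Section FerrersReduction.
Variables (K : fieldType) (n m : nat) (lam : nat -> nat).
Hypothesis lamS : forall i : nat, (1 <= i)%N -> (i < n)%N -> (lam i.+1 <= lam i)%N.

Lemma lam_anti i j : (1 <= i)%N -> (i <= j)%N -> (j <= n)%N -> (lam j <= lam i)%N.
Proof.
move=> i1 /subnKC <-; elim: (j - i)%N => [|d IH]; first by rewrite addn0.
by rewrite addnS => hj; apply: leq_trans (IH _); [apply: lamS|]; lia.
Qed.

Hypothesis lam1 : lam 1%N = m.
Hypothesis lamn : (n <= lam n)%N.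

Local Notation x := (xvar K m).
Local Notation I := (ferrers_spec K m n lam).
Local Notation J := (ferrers_diag_ideal K m n lam).
Local Notation D := (ferrers_diag K m n lam).

Lemma lam_le i : (1 <= i)%N -> (i <= n)%N -> (n <= lam i <= m)%N.
Proof.
move=> i1 ni; rewrite -lam1 (lam_anti _ i1) // andbT.
by apply: leq_trans lamn (lam_anti _ _ _).
Qed.

(** Positions left of the main diagonal are allowed: if [j < i], swapping the factors works because
    [i <= n <= lam j]. *)
Lemma ferrers_mem i j : (1 <= i <= n)%N -> (1 <= j <= lam i)%N -> I (x i * x j).
Proof.
move=> /andP[i1 ni] /andP[j1 hj]; have [hij|hji] := leqP i j.
  by apply: mem_ideal_gen; exists i, j; rewrite i1 ni hij hj.
apply: mem_ideal_gen; exists j, i; rewrite mulrC j1; split=> //; first lia.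
by have /andP[] := lam_le j1 (ltac:(lia)); lia.
Qed.

Lemma ferrers_diag_mem k : I (D k).
Proof.
rewrite /ferrers_diag big_seq_cond; apply: is_ideal_sum; first exact: ideal_gen_ideal.
by move=> i; rewrite mem_index_iota => hi; apply: ferrers_mem; lia.
Qed.

Lemma ferrers_diag_ideal_sub : ideal_sub J I.
Proof.
apply: ideal_gen_min; first exact: ideal_gen_ideal.
by move=> _ [k [_ ->]]; apply: ferrers_diag_mem.
Qed.

(** Induction on [m - k], from the outermost diagonal inwards. For rows [j < i], the product of the
    two entries of diagonal [k] regroups as [x j * x (k + i)], on diagonal [k + i - j], times
    [x i * x (k + j)], which lies in [I]. *)
Lemma ferrers_entry_nil k i : (1 <= i <= n)%N -> (k + i <= lam i)%N ->
  rees_nil J I 0 (x i * x (k + i)).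
Proof.
move: {2}(m - k)%N (leqnn (m - k)) => d; elim: d k i => [|d IH] k i hkd hi hki.
  by have := lam_le (i := i); lia.
have hm : (k < m)%N by have := lam_le (i := i); lia.
apply: rees_nil_sqr; first by apply: ferrers_mem; lia.
have -> : (x i * x (k + i)) ^+ 2 = D k * (x i * x (k + i)) -
   \sum_(1 <= j < n.+1 | (k + j <= lam j)%N && (j != i)) (x i * x (k + i)) * (x j * x (k + j)).
  rewrite /ferrers_diag -big_filter (bigD1_seq i) ?filter_uniq ?iota_uniq //=; last first.
    by rewrite mem_filter mem_index_iota hki; lia.
  rewrite big_filter_cond.
  by rewrite -mulr_sumr; ring.
have sJI := ferrers_diag_ideal_sub.
apply: rees_nilD.
  apply: rees_nil_mul => //; apply: ideal_mul_mem; first by apply: mem_ideal_gen; exists k.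
  by apply: ideal_pow1; apply: ferrers_mem; lia.
apply: rees_nilN; rewrite big_seq_cond; apply: rees_nil_sum => // j.
rewrite mem_index_iota => /andP[hj /andP[hkj nji]].
have [lji|lij] := ltnP j i.
  have -> : x i * x (k + i) * (x j * x (k + j)) = (x j * x ((k + i - j) + j)%N) * (x i * x (k + j)).
    by rewrite subnK; [ring|lia].
  have laij : (lam i <= lam j)%N by apply: lam_anti; lia.
  apply: (@rees_nilM _ _ _ 0 1); first by apply: IH; lia.
  by apply: ideal_pow1; apply: ferrers_mem; lia.
have {nji}lij : (i < j)%N by lia.
have -> : x i * x (k + i) * (x j * x (k + j)) = (x i * x ((k + j - i) + i)%N) * (x j * x (k + i)).
  by rewrite subnK; [ring|lia].
have laij : (lam j <= lam i)%N by apply: lam_anti; lia.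
apply: (@rees_nilM _ _ _ 0 1); first by apply: IH; lia.
by apply: ideal_pow1; apply: ferrers_mem; lia.
Qed.

(** The pigeonhole needs generators indexed by a finite type; positions outside the tableau get 0,
    which is harmless. *)
Definition ferrers_entry (ij : 'I_n.+1 * 'I_m.+1) : polyring K m :=
  if [&& (0 < ij.1)%N, (ij.1 <= ij.2)%N & (ij.2 <= lam ij.1)%N] then x ij.1 * x ij.2 else 0.

Lemma ferrers_entry_surj p :
  (exists i j : nat, [/\ (1 <= i <= n)%N, (i <= j <= lam i)%N & p = x i * x j]) ->
  exists ij, p = ferrers_entry ij.
Proof.
move=> [i [j [hi hj ->]]]; have hm : (lam i <= m)%N by have := lam_le (i := i); lia.
have hi' : (i < n.+1)%N by lia. have hj' : (j < m.+1)%N by lia.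
exists (Ordinal hi', Ordinal hj'); rewrite /ferrers_entry /=.
by have -> : [&& (0 < i)%N, (i <= j)%N & (j <= lam i)%N] by lia.
Qed.

Lemma ferrers_reduction : is_reduction J I.
Proof.
split; [exact: ideal_gen_ideal | exact: ferrers_diag_ideal_sub |].
have sJI := ferrers_diag_ideal_sub.
have [r hr] : exists r, ideal_sub (ideal_pow I r.+1) (ideal_mul J (ideal_pow I r)).
  apply: (reduction_of_nil ferrers_entry_surj) => -[i j]; rewrite /ferrers_entry /=.
  case: ifP => [/and3P[i1 ij hj]|_]; last first.
    apply: rees_nil_mul => //.
    by case: (ideal_mul_ideal J (ideal_pow I 0)).
  have hi := ltn_ord i.
  by rewrite -[nat_of_ord j](subnK ij); apply: ferrers_entry_nil; rewrite ?subnK //; lia.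
exists r => p; split; first exact: hr.
exact: ideal_mulS.
Qed.

End FerrersReduction.

(** * Residue fields *)

Section ResidueField.
Variable R : comNzRingType.

Lemma maximal_ideal_exists (Q : R -> Prop) : is_ideal Q -> ~ Q 1 ->
  exists M : R -> Prop, [/\ is_ideal M, ideal_sub Q M, ~ M 1 &
    forall a, ~ M a -> exists b, M (1 - b * a)].
Proof.
move=> idQ Q1; have [Q0 QD QM] := idQ.
pose good (M : R -> Prop) := [/\ is_ideal M, ideal_sub Q M & ~ M 1].
have [F FP Ftot|M [goodM maxM]] :=
    @Zorn_bigcup R (fun M : set R => (forall a, ~ M a) \/ good M).
  have [[X [FX goodX]]|noX] := pselect (exists X, F X /\ good X); last first.
    left=> a [X FX Xa]; have [/(_ a)//|goodX] := FP _ FX.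
    by apply: noX; exists X.
  right; have inF Y a : F Y -> Y a -> good Y.
    by move=> /FP[/(_ a)//|].
  split.
  - split.
    + by exists X => //; case: goodX => -[].
    + move=> a b [Y FY Ya] [Z FZ Zb].
      have [sYZ|sZY] := Ftot _ _ FY FZ.
        by exists Z => //; have [[_ + _] _ _] := inF _ _ FZ Zb; apply=> //; apply: sYZ.
      by exists Y => //; have [[_ + _] _ _] := inF _ _ FY Ya; apply=> //; apply: sZY.
    + move=> r a [Y FY Ya]; exists Y => //.
      by have [[_ _ +] _ _] := inF _ _ FY Ya; apply.
  - by move=> a Qa; exists X => //; case: goodX => _ + _; apply.
  - by move=> [Y FY Y1]; have [_ _] := inF _ _ FY Y1.
have {}goodM : good M.
  case: goodM => // M0; exfalso; apply: (maxM Q); last by right; split.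
  by split=> [a /M0//|/(_ 0 Q0) /M0].
have [idM sQM M1] := goodM; exists M; split=> // a Ma.
have [M0 MD MM] := idM.
apply: contrapT => /forallNP h.
(* This is the ideal generated by [M] and [a]; it is proper if [a] has no inverse modulo [M],
   against maximality. *)
pose N (c : R) := exists b, M (c - b * a).
apply: (maxM (N : set R)).
  split; first by move=> c Mc; exists 0; rewrite mul0r subr0.
  by move=> /(_ a) sub; apply/Ma/sub; exists 1; rewrite mul1r subrr.
right; split=> //.
- split; first by exists 0; rewrite mul0r subrr.
    move=> c c' [b hb] [b' hb']; exists (b + b').
    by have := MD _ _ hb hb'; congr M; ring.
  by move=> r c [b hb]; exists (r * b); have := MM r _ hb; congr M; ring.
- by move=> c /sQM Mc; exists 0; rewrite mul0r subr0.
- by move=> [b hb]; apply: (h b).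
Qed.

Lemma residue_field_exists (Q : R -> Prop) : is_ideal Q -> ~ Q 1 ->
  exists (L : fieldType) (psi : {rmorphism R -> L}), forall a, Q a -> psi a = 0.
Proof.
move=> idQ Q1; have [M [[M0 MD MM] sQM M1 maxM]] := maximal_ideal_exists idQ Q1.
pose S : pred R := fun a => `[< M a >].
have idS : idealr_closed S.
  split; [by apply/asboolP | by apply/negP => /asboolP|].
  by move=> r a b /asboolP Ma /asboolP Mb; apply/asboolP/MD => //; apply: MM.
pose I0 : idealr R := HB.pack S (isIdealr.Build R S idS).
pose Q0 : comNzRingType := {ideal_quot I0}.
pose pi : {rmorphism R -> Q0} := (\pi_({ideal_quot I0}))%qT.
have pi0 a : (pi a == 0) = S a.
  by rewrite -[0](rmorph0 pi) /= -Quotient.idealrBE subr0.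
have surj (u : Q0) : exists a, u = pi a by exists (repr u); rewrite /= reprK.
(* The inverse is chosen to be 0 at 0, as the field structure requires. *)
have invE (u : Q0) : exists v, (u != 0 -> v * u = 1) /\ (u = 0 -> v = 0).
  have [a ->] := surj u; case: (eqVneq (pi a) 0) => [_|h]; first by exists 0.
  have Ma : ~ M a by apply/asboolPn; rewrite pi0 in h.
  have [b hb] := maxM a Ma; exists (pi b); split=> [_|/eqP]; last by rewrite (negPf h).
  apply/esym/eqP; rewrite -rmorphM -subr_eq0 -(rmorph1 pi) -rmorphB pi0.
  exact/asboolP.
have [inv hinv] := choice invE.
have mulV (u : Q0) : u != 0 -> inv u * u = 1 by case: (hinv u).
have inv0 : inv 0 = 0 by case: (hinv 0) => _; apply.
pose L : fieldType := HB.pack Q0 (GRing.ComNzRing_isField.Build Q0 mulV inv0).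
exists L, pi => a /sQM Ma; apply/eqP; rewrite pi0; exact/asboolP.
Qed.

End ResidueField.

(** * Morphisms out of polynomial rings, spans and monomials *)

(** Used with [s] the evaluation at [t = 0]: the variables can be sent to any curve passing through
    the point [psi]. Constants go through [u] and [psi], and each further variable is added by
    Horner evaluation. *)
Lemma polyring_lift (K L S A : comNzRingType) m (psi : {rmorphism polyring K m -> L})
    (u : {rmorphism L -> S}) (s : {rmorphism S -> A}) (v : nat -> S) :
    (forall i, (i < m)%N -> s (v i) = s (u (psi (var K m i)))) ->
  exists Phi : {rmorphism polyring K m -> S},
    (forall i, (i < m)%N -> Phi (var K m i) = v i) /\
    forall p, s (Phi p) = s (u (psi p)).
Proof.
elim: m psi => [|m IH] psi hv.
  by exists (u \o psi : {rmorphism _ -> _}).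
pose psi' : {rmorphism polyring K m -> L} := psi \o (@polyC (polyring K m)).
have [|Phi' [Phi'v Phi'p]] := IH psi'.
  by move=> i hi; rewrite hv /=; [rewrite ltn_eqF | lia].
have cfu : commr_rmorph Phi' (v m) by move=> ?; apply: mulrC.
exists (horner_morph cfu : {rmorphism _ -> _}); split.
  move=> i; rewrite ltnS leq_eqVlt /= => /orP[/eqP->|hi].
    by rewrite eqxx horner_morphX.
  by rewrite ltn_eqF // horner_morphC Phi'v.
move=> p; elim/poly_ind: (p : {poly polyring K m}) => [|q c IHq].
  by rewrite !rmorph0.
rewrite !rmorphD !rmorphM /= IHq horner_morphC horner_morphX Phi'p hv //= eqxx.
by [].
Qed.

Section Span.
Variable L : fieldType.
Implicit Types (s : seq {poly L}) (a b : {poly L}).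

Definition inspan s a := exists c : nat -> L, a = \sum_(i < size s) c i *: s`_i.

Lemma inspan_min s (V : {poly L} -> Prop) : V 0 -> (forall a b, V a -> V b -> V (a + b)) ->
  (forall c a, V a -> V (c *: a)) -> (forall a, a \in s -> V a) -> forall a, inspan s a -> V a.
Proof.
move=> V0 VD VZ Vs _ [c ->]; apply: big_ind => // i _.
by apply/VZ/Vs/mem_nth.
Qed.

Lemma inspan0 s : inspan s 0.
Proof. by exists (fun=> 0); rewrite big1 // => i _; rewrite scale0r. Qed.

Lemma inspanD s a b : inspan s a -> inspan s b -> inspan s (a + b).
Proof.
move=> [c ->] [c' ->]; exists (fun i => c i + c' i); rewrite -big_split /=.
by apply: eq_bigr => i _; rewrite scalerDl.
Qed.

Lemma inspanZ s c a : inspan s a -> inspan s (c *: a).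
Proof.
move=> [c' ->]; exists (fun i => c * c' i); rewrite scaler_sumr.
by apply: eq_bigr => i _; rewrite scalerA.
Qed.

Lemma mem_inspan s a : a \in s -> inspan s a.
Proof.
move=> ha; exists (fun i => (i == index a s)%:R).
have hi : (index a s < size s)%N by rewrite index_mem.
rewrite (bigD1 (Ordinal hi)) //= eqxx scale1r nth_index // big1 ?addr0 // => i.
by move=> /negPf; rewrite -val_eqE /= => ->; rewrite scale0r.
Qed.

Lemma inspanM s s' s'' a b : (forall u v, u \in s -> v \in s' -> inspan s'' (u * v)) ->
  inspan s a -> inspan s' b -> inspan s'' (a * b).
Proof.
move=> h + hb; apply: (inspan_min (V := fun a => inspan s'' (a * b))).
- by rewrite mul0r; apply: inspan0.
- by move=> u v hu hv; rewrite mulrDl; apply: inspanD.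
- by move=> c u hu; rewrite -scalerAl; apply: inspanZ.
move=> u hu; move: hb; apply: (inspan_min (V := fun b => inspan s'' (u * b))).
- by rewrite mulr0; apply: inspan0.
- by move=> v w hv hw; rewrite mulrDr; apply: inspanD.
- by move=> c v hv; rewrite -scalerAr; apply: inspanZ.
by move=> v; apply: h.
Qed.

(** Taking coefficients turns the hypothesis into a factorization of the identity matrix of size [N]
    through dimension [size s]. *)
Lemma inspan_size s N : (forall i, (i < N)%N -> inspan s 'X^i) -> (N <= size s)%N.
Proof.
move=> h; have /choice[c hc] : forall i : 'I_N, exists c : nat -> L,
    'X^i = \sum_(j < size s) c j *: s`_j by move=> i; apply: h.
pose C := \matrix_(i < N, j < size s) c i j.
pose G := \matrix_(j < size s, i < N) (s`_j)`_i.
have CG : C *m G = 1%:M.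
  apply/matrixP => i k; rewrite !mxE.
  have := congr1 (fun p : {poly L} => p`_k) (hc i); rewrite coefXn coef_sum eq_sym => hk.
  rewrite -val_eqE /= hk; apply: eq_bigr => j _; rewrite !mxE coefZ //.
by have := mxrankM_maxl C G; rewrite CG mxrank1 => /leq_trans; apply; apply: rank_leq_col.
Qed.

(** Pascal recursion on the list and the degree: a monomial either avoids the head [h] or is [h]
    times one of lower degree. *)
Fixpoint monomials (hs : seq {poly L}) : nat -> seq {poly L} :=
  if hs is h :: hs' then
    fix rec d := if d is d'.+1 then monomials hs' d ++ [seq h * u | u <- rec d'] else [:: 1]
  else fun d => if d is 0 then [:: 1] else [::].

Lemma monomialsM hs d h u : h \in hs -> u \in monomials hs d -> h * u \in monomials hs d.+1.
Proof.
elim: hs d u => [|h0 hs IH] //; elim=> [|d IHd] u hh hu.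
  rewrite /= mem_cat; move: hu; rewrite inE => /eqP ->.
  move: hh; rewrite inE => /orP[/eqP->|hh]; first by rewrite inE eqxx orbT.
  apply/orP; left; apply: (IH 0%N) => //.
  by case: (hs) => [|? ?]; rewrite /= inE.
rewrite [monomials _ _]/= mem_cat; move: (hh); rewrite inE => /orP[/eqP->|hh'].
  by rewrite map_f ?orbT.
move: hu; rewrite [monomials _ _]/= mem_cat => /orP[hu|/mapP[w hw ->]].
  by apply/orP; left; apply: IH.
by rewrite mulrCA; apply/orP; right; apply: map_f; apply: IHd.
Qed.

(** A crude form of the growth of order [size hs - 1] in [d]; the extra factor on the left avoids a
    truncated exponent when [hs] is empty. *)
Lemma size_monomials hs d : (d.+1 * size (monomials hs d) <= d.+1 ^ size hs)%N.
Proof.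
elim: hs d => [|h hs IH] d; first by case: d => [|d]; rewrite ?muln0.
elim: d => [|d IHd]; first by rewrite exp1n.
rewrite [monomials _ _]/= size_cat size_map -/(monomials (h :: hs) d) mulnDr.
have {}IHd : (size (monomials (h :: hs) d) <= d.+1 ^ size hs)%N.
  by move: IHd; rewrite expnS leq_pmul2l.
have IH1 := IH d.+1.
case: hs IH IH1 IHd => [|h' hs] IH IH1 IHd.
  by rewrite [monomials [::] _]/= muln0 add0n expn1 -[leqRHS]muln1 leq_pmul2l.
rewrite [size (_ :: _ :: _)]/= [(d.+2 ^ _.+2)%N]expnS.
rewrite [X in (_ <= X)%N]mulSn leq_add //.
apply: (@leq_trans (d.+2 * d.+1 ^ (size hs).+1)); first by rewrite leq_pmul2l.
rewrite !expnS mulnCA leq_pmul2l // leq_pmul2l //.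
by case: (size hs) => // k; rewrite leq_exp2r.
Qed.
End Span.

(** * Growth of leading forms *)

Section Growth.
Variables (P : comNzRingType) (L : fieldType) (psi : {rmorphism P -> L}).
Variable Phi : {rmorphism P -> {poly {poly L}}}.
Hypothesis Phi0 : forall p, (Phi p)`_0 = (psi p)%:P.

(* [Phi f] vanishes to order [n] at [t = 0] ([t] the outer variable), with [t^n]-coefficient [a]. *)
Definition lead n f a := exists F, Phi f = 'X^n * F /\ F`_0 = a.

Lemma lead_eq_coef n f a : lead n f a -> a = (Phi f)`_n.
Proof. by move=> [F [-> <-]]; rewrite coefXnM ltnn subnn. Qed.

Lemma lead0 n : lead n 0 0.
Proof. by exists 0; rewrite rmorph0 mulr0 coef0. Qed.

Lemma leadC p : lead 0 p (psi p)%:P.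
Proof. by exists (Phi p); rewrite mul1r. Qed.

Lemma leadD n f g a b : lead n f a -> lead n g b -> lead n (f + g) (a + b).
Proof. by move=> [F [hF <-]] [G [hG <-]]; exists (F + G); rewrite rmorphD hF hG mulrDr coefD. Qed.

Lemma leadM n k f g a b : lead n f a -> lead k g b -> lead (n + k) (f * g) (a * b).
Proof.
move=> [F [hF <-]] [G [hG <-]]; exists (F * G); rewrite rmorphM hF hG exprD coef0M.
by split=> //; ring.
Qed.

Lemma leadZ n p f a : lead n f a -> lead n (p * f) (psi p *: a).
Proof. by rewrite -mul_polyC; apply: leadM (leadC p). Qed.

Lemma lead_sum n (T : Type) (s : seq T) (Q : pred T) (F : T -> P) (A : T -> {poly L}) :
  (forall i, Q i -> lead n (F i) (A i)) ->
  lead n (\sum_(i <- s | Q i) F i) (\sum_(i <- s | Q i) A i).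
Proof.
by move=> h; apply: (big_ind2 (fun f a => lead n f a)) => //; [apply: lead0|move=> *; apply: leadD].
Qed.

Lemma leadX n k f a : lead n f a -> lead (k * n) (f ^+ k) (a ^+ k).
Proof.
move=> h; elim: k => [|k IH]; first by have := leadC 1; rewrite rmorph1.
by rewrite mulSn !exprS; apply: leadM.
Qed.

Lemma lead_prod n (T : Type) (t : seq T) (g : T -> P) : (forall i, exists a, lead n (g i) a) ->
  exists a, lead (size t * n) (\prod_(i <- t) g i) a.
Proof.
move=> h; elim: t => [|i t [a IH]].
  by exists 1; rewrite big_nil; have := leadC 1; rewrite rmorph1.
by have [b hb] := h i; exists (b * a); rewrite big_cons mulSn; apply: leadM.
Qed.

(** The value of [Phi p] at [t = 0] is the scalar [psi p], so multiplication by ring elements only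
    rescales leading coefficients and keeps them in an [L]-span. *)
Lemma inspan_lead_ideal s n : is_ideal (fun f => exists2 a, inspan s a & lead n f a).
Proof.
split; first by exists 0; [apply: inspan0|apply: lead0].
  by move=> f g [a sa ha] [b sb hb]; exists (a + b); [apply: inspanD|apply: leadD].
by move=> p f [a sa ha]; exists (psi p *: a); [apply: inspanZ|apply: leadZ].
Qed.

Variables (T : finType) (g : T -> P) (S : P -> Prop).
Hypothesis hS : forall x, S x -> exists i, x = g i.
Hypothesis lead_g : forall i, exists a, lead 2 (g i) a.
Local Notation I := (ideal_gen S).

Variables (J : P -> Prop) (hs : seq {poly L}) (r : nat).
Hypothesis lead_J : forall e, J e -> exists2 a, inspan hs a & lead 2 e a.
Hypothesis red : ideal_sub (ideal_pow I r.+1) (ideal_mul J (ideal_pow I r)).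

(** Each use of the reduction splits off one factor of [J], whose leading coefficient is in the span
    of [hs]. After [d] uses there remain a degree [d] monomial in [hs] and a product of [r]
    generators of [I]. *)
Lemma inspan_pow d f : ideal_pow I (r + d) f ->
  exists2 a, inspan [seq u * v | u <- monomials hs d,
      v <- [seq (Phi (\prod_(i <- t) g i))`_(r * 2) | t : r.-tuple T]] a &
    lead ((r + d) * 2) f a.
Proof.
set B := [seq _ | t : _].
elim: d f => [|d IH] f.
  rewrite addn0 => /(ideal_pow_gen hS).
  apply: (ideal_gen_min (inspan_lead_ideal _ _)).
  move=> _ [t ->]; have [a ha] := lead_prod t lead_g; rewrite size_tuple in ha.
  exists a => //; apply: mem_inspan; rewrite (lead_eq_coef ha) -[X in X \in _]mul1r.
  by apply: allpairs_f; [case: (hs) => [|? ?]; rewrite /= inE|apply/mapP; exists t; rewrite ?mem_enum].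
rewrite addnS => /(reduction_pow red); apply: (ideal_gen_min (inspan_lead_ideal _ _)).
move=> _ [e [f' [/lead_J[b sb hb] /IH[a sa ha] ->]]].
exists (b * a); last by rewrite mulSn; apply: leadM.
apply: inspanM sb sa => u v hu /allpairsP[[w x] /= [hw hx ->]].
by apply: mem_inspan; rewrite mulrA; apply: allpairs_f => //; apply: monomialsM.
Qed.

Variables (q N : nat).
Hypothesis N_gt0 : (0 < N)%N.
Hypothesis hY0 : exists Y c, [/\ I Y, c != 0 & lead 2 Y (c *: 1)].
Hypothesis hY : forall d, (d < q)%N -> exists Y c, [/\ I Y, c != 0 & lead 2 Y (c *: 'X^(N ^ d))].

(** Write [a] in base [N]: the digit [b] at place [u] is realized by [b] factors [Y], and [N - b]
    factors [Y0] of exponent 0 keep the degree independent of [a]. *)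
Lemma pow_lead_Xn u a : (u <= q)%N -> (a < N ^ u)%N ->
  exists f c, [/\ ideal_pow I (u * N) f, c != 0 & lead ((u * N) * 2) f (c *: 'X^a)].
Proof.
have [Y0 [c0 [IY0 c00 lY0]]] := hY0.
elim: u a => [|u IH] a hu ha.
  have -> : a = 0%N by move: ha; rewrite expn0; lia.
  exists 1, 1; split; [exact: ideal_pow0|exact: oner_neq0|].
  by have := leadC 1; rewrite rmorph1 scale1r.
have [Y [c [IY cn0 lY]]] := hY hu.
have Nu0 : (0 < N ^ u)%N by rewrite expn_gt0 N_gt0.
have hb : (a %/ N ^ u < N)%N by rewrite ltn_divLR // -expnS.
have [f [c' [If c'0 lf]]] := IH (a %% N ^ u)%N (ltnW hu) (ltn_pmod _ Nu0).
set b := (a %/ N ^ u)%N in hb.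
exists (Y ^+ b * Y0 ^+ (N - b) * f), (c ^+ b * c0 ^+ (N - b) * c').
have -> : (u.+1 * N = b * 1 + (N - b) * 1 + u * N)%N by rewrite mulSn; lia.
split.
- by do 2?[apply: ideal_powD => //]; apply: ideal_powX; apply: ideal_pow1.
- by rewrite !mulf_neq0 ?expf_neq0.
have -> : (c ^+ b * c0 ^+ (N - b) * c') *: 'X^a =
    (c *: 'X^(N ^ u)) ^+ b * (c0 *: 1) ^+ (N - b) * (c' *: 'X^(a %% N ^ u)).
  rewrite {1}(divn_eq a (N ^ u)) -/b exprD [(b * _)%N]mulnC exprM !exprZn expr1n.
  by rewrite -!mul_polyC !polyCM !polyC_exp; ring.
by rewrite !mulnDl !muln1; apply: leadM => //; apply: leadM; apply: leadX.
Qed.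

Lemma fiber_growth :
  (N ^ q <= size (monomials hs (q.+1 * N)) * #|T| ^ r)%N.
Proof.
have [Y0 [c0 [IY0 c00 lY0]]] := hY0.
have hsz : size [seq u * v | u <- monomials hs (q.+1 * N),
      v <- [seq (Phi (\prod_(i <- t) g i))`_(r * 2) | t : r.-tuple T]]
    = (size (monomials hs (q.+1 * N)) * #|T| ^ r)%N.
  by rewrite size_allpairs size_map -cardE card_tuple.
rewrite -hsz; apply: inspan_size => a /(pow_lead_Xn (leqnn q))[f [c [If cn0 lf]]].
(* The factor [Y0 ^+ (r + N)] raises the degree from [q * N] to [r + q.+1 * N] without changing the
   power of ['X]. *)
have [|b sb lb] := @inspan_pow (q.+1 * N) (f * Y0 ^+ (r + N)).
  have -> : (r + q.+1 * N = q * N + (r + N) * 1)%N by rewrite mulSn; lia.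
  by apply: ideal_powD => //; apply: ideal_powX; apply: ideal_pow1.
have lf' : lead ((r + q.+1 * N) * 2) (f * Y0 ^+ (r + N)) ((c *: 'X^a) * (c0 *: 1) ^+ (r + N)).
  have -> : ((r + q.+1 * N) * 2 = q * N * 2 + (r + N) * 2)%N by rewrite mulSn; lia.
  by apply: leadM => //; apply: leadX.
have e : b = (c * c0 ^+ (r + N)) *: 'X^a.
  rewrite (lead_eq_coef lb) -(lead_eq_coef lf') exprZn expr1n.
  by rewrite -!mul_polyC !polyCM; ring.
have -> : 'X^a = (c * c0 ^+ (r + N))^-1 *: b.
  by rewrite e scalerA mulVf ?scale1r // mulf_neq0 ?expf_neq0.
exact: inspanZ.
Qed.

End Growth.

(** The left side of the last hypothesis has order [q] in [N], while at most [q] forms have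
    monomials growing with order at most [q - 1]; hence [N] is bounded. *)
Lemma growth_bound (L : fieldType) (hs : seq {poly L}) q C N : (0 < N)%N -> (size hs <= q)%N ->
  (N ^ q <= size (monomials hs (q.+1 * N)) * C)%N -> (N < C * q.+2 ^ q)%N.
Proof.
move=> N0 hq h; set d := (q.+1 * N)%N in h.
have dN : (N < d.+1 <= q.+2 * N)%N by rewrite /d; nia.
have Nq : (0 < N ^ q)%N by rewrite expn_gt0 N0.
suff : (d.+1 <= C * q.+2 ^ q)%N by lia.
rewrite -(leq_pmul2r Nq) -mulnA -expnMn.
apply: (@leq_trans (d.+1 * (size (monomials hs d) * C))); first by rewrite leq_pmul2l.
rewrite mulnA mulnC leq_mul2l; apply/orP; right.
apply: leq_trans (size_monomials hs d) _.
apply: (@leq_trans (d.+1 ^ q)); first by rewrite leq_pexp2l.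
by case: (q) dN => [//|q'] dN; rewrite leq_exp2r //; case/andP: dN.
Qed.

(** * Minimality *)

Lemma ideal_gen_family (R : comNzRingType) (T : finType) (g : T -> R) f :
  ideal_gen (fun h => exists a, h = g a) f -> exists p : T -> R, f = \sum_a p a * g a.
Proof.
move: f; apply: ideal_gen_min.
  split.
  - by exists (fun=> 0); rewrite big1 // => a _; rewrite mul0r.
  - move=> _ _ [p ->] [p' ->]; exists (fun a => p a + p' a); rewrite -big_split /=.
    by apply: eq_bigr => a _; rewrite mulrDl.
  move=> r _ [p ->]; exists (fun a => r * p a); rewrite mulr_sumr.
  by apply: eq_bigr => a _; rewrite mulrA.
move=> _ [a ->]; exists (fun b => (b == a)%:R).
by rewrite (bigD1 a) //= eqxx mul1r big1 ?addr0 // => b /negPf ->; rewrite mul0r.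
Qed.

(** Greedy choice: add a vector of [W] outside the current row space until there are [k] rows or
    none is left. [W] need not be a subspace. *)
Lemma free_rows_or_submx (L : fieldType) l (W : 'rV[L]_l -> Prop) k :
  (exists A : 'M[L]_(k, l), (forall i, W (row i A)) /\ row_free A) \/
  (exists c (H : 'M[L]_(c, l)), (c < k)%N /\ forall w, W w -> (w <= H)%MS).
Proof.
elim: k => [|k [[A [hA rA]]|[c [H [hc hH]]]]].
- by left; exists 0; split; [case|rewrite /row_free mxrank0].
- have [hW|/existsNP[w /not_implyP[Ww /negP wA]]] := pselect (forall w, W w -> (w <= A)%MS).
    by right; exists k, A.
  left; rewrite -addn1; exists (col_mx A w); split.
    move=> i; rewrite -[i]splitK; case: (split i) => j /=.
      by rewrite rowKu.
    by rewrite rowKd row_id.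
  have : (A < A + w)%MS by rewrite ltmxE addsmxSl /= addsmx_sub submx_refl.
  move/rank_ltmx; rewrite (eqP rA) addsmxE => h.
  by rewrite /row_free eqn_leq rank_leq_row; lia.
by right; exists c, H; split=> //; apply: ltnW.
Qed.

Lemma prefix_pred (p : pred nat) n : (forall i, (1 <= i)%N -> (i < n)%N -> p i.+1 -> p i) ->
  exists s, (s <= n)%N /\ forall i, (1 <= i <= n)%N -> p i = (i <= s)%N.
Proof.
elim: n => [|n IH] h; first by exists 0%N; split=> // i; lia.
have [i i1 hi|s [sn hs]] := IH; first by apply: h => //; lia.
case pn : (p n.+1); last first.
  exists s; split=> [|i hi]; first lia.
  by case: (eqVneq i n.+1) => [->|ni]; rewrite ?pn ?hs; lia.
exists n.+1; split=> // i hi; case: (eqVneq i n.+1) => [->|ni]; first by rewrite pn leqnn.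
have pn' : p n by apply: h => //; lia.
by rewrite hs; [have := hs n|]; rewrite ?pn'; lia.
Qed.

Section FerrersMinimal.
Variables (K : fieldType) (n m : nat) (lam : nat -> nat).
Hypothesis n_gt0 : (0 < n)%N.
Hypothesis lamS : forall i : nat, (1 <= i)%N -> (i < n)%N -> (lam i.+1 <= lam i)%N.
Hypothesis lam1 : lam 1%N = m.
Hypothesis lamn : (n <= lam n)%N.

Local Notation x := (xvar K m).
Local Notation I := (ferrers_spec K m n lam).
Local Notation J := (ferrers_diag_ideal K m n lam).
Local Notation D := (ferrers_diag K m n lam).

Variables (L : fieldType) (psi : {rmorphism polyring K m -> L}).

Lemma ferrers_split_index : (forall i, (1 <= i <= n)%N -> psi (x i) = 0) -> exists s l : nat,
  [/\ (s <= n)%N, (n <= l <= m)%N, l = (if (s < n)%N then lam s.+1 else n),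
      forall i, (1 <= i <= l)%N -> psi (x i) = 0 &
      forall i, (1 <= i <= s)%N -> exists j, (l < j <= lam i)%N /\ psi (x j) != 0].
Proof.
(* [p i] says that row [i] reaches a variable not killed by [psi]. Rows get shorter, so [p] holds on
   an initial segment of rows, and its failure at row [s + 1] kills all variables up to [l]. *)
move=> psi0; pose p i := [exists j : 'I_(lam i).+1, (0 < j)%N && (psi (x j) != 0)].
have [i i1 ni /existsP[j hj]|s [sn hs]] := @prefix_pred p n.
  have hl := lamS i1 ni.
  have hji : (j < (lam i).+1)%N by have := ltn_ord j; lia.
  by apply/existsP; exists (Ordinal hji).
exists s, (if (s < n)%N then lam s.+1 else n).
set l := (if _ then _ else _).
have nlm : (n <= l <= m)%N.
  rewrite /l; case: ifP => [sn'|_]; first exact: lam_le.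
  by have := lam_le lamS lam1 lamn (leqnn 1) n_gt0; lia.
have l0 i : (1 <= i <= l)%N -> psi (x i) = 0.
  rewrite /l; case: ifP => [sn'|_]; last exact: psi0.
  move=> hi; apply/eqP; apply: contraFT (ltnn s) => hx.
  rewrite -hs; last lia.
  have hi' : (i < (lam s.+1).+1)%N by lia.
  by apply/existsP; exists (Ordinal hi'); rewrite /= hx andbT; lia.
split=> // i hi; have : p i by rewrite hs; lia.
move=> /existsP[j /andP[j0 hj]]; exists j; split=> //.
have := ltn_ord j; rewrite ltnS => ->; rewrite andbT ltnNge.
by apply: contra hj => hj; apply/eqP/l0; rewrite j0.
Qed.

Variables (s l : nat).
Hypothesis s_le : (s <= n)%N.
Hypothesis n_le_l : (n <= l <= m)%N.
Hypothesis lE : l = (if (s < n)%N then lam s.+1 else n).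
Hypothesis psi_l : forall i, (1 <= i <= l)%N -> psi (x i) = 0.
Hypothesis psi_s : forall i, (1 <= i <= s)%N -> exists j, (l < j <= lam i)%N /\ psi (x j) != 0.

Definition local_gen (a : 'I_l) : polyring K m := if (a < s)%N then x a.+1 else D (a - s).

Lemma lam_le_l i : (s < i <= n)%N -> (lam i <= l)%N.
Proof.
move=> hi; rewrite lE; case: ifP => h; last lia.
by apply: (lam_anti lamS); lia.
Qed.

(** On a diagonal [k >= l - s], an entry in a row [i > s] would have column [k + i > l >= lam i]; so
    only the first [s] rows contribute, and the diagonal lies in the ideal of [x_1, ..., x_s]. *)
Lemma diag_local_gen f : J f -> exists p : 'I_l -> polyring K m, f = \sum_a p a * local_gen a.
Proof.
move=> hf; apply: ideal_gen_family; move: f hf.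
set E := ideal_gen _; have idE : is_ideal E by apply: ideal_gen_ideal.
apply: (ideal_gen_min idE) => _ [k [_ ->]].
have [hk|hk] := ltnP (s + k) l.
  apply: mem_ideal_gen; exists (Ordinal hk).
  by rewrite /local_gen /= ltnNge leq_addr /= addKn.
rewrite /ferrers_diag big_seq_cond; apply: is_ideal_sum => // i.
rewrite mem_index_iota => /andP[hi hki].
have his : (i <= s)%N.
  by rewrite leqNgt; apply/negP => hsi; have := @lam_le_l i; lia.
have hil : (i.-1 < l)%N by lia.
rewrite mulrC; case: idE => _ _; apply; apply: mem_ideal_gen; exists (Ordinal hil).
have hi1 : i.-1.+1 = i by lia.
by rewrite /local_gen /= hi1 his.
Qed.

Section Curve.
Variable N : nat.

(* The curve [x_i = z^(e i) t^(w i)] through the residue point: [i0] carries [z^0], the other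
   [l - 1] coordinates below [l] carry [z^(N^0), z^(N^1), ...]. *)
Let i0 := if (s < n)%N then s.+1 else 1%N.
Definition curve_exp i :=
  if i == i0 then 0%N else (if (i < i0)%N then N ^ i.-1 else N ^ i.-2)%N.

Definition curve (k : nat) : {poly {poly L}} :=
  let i := k.+1 in
  if (i <= s)%N then 'X^2 * ('X^(curve_exp i))%:P
  else if (i <= l)%N then 'X * ('X^(curve_exp i))%:P
  else (psi (x i))%:P%:P.

Lemma curve_morphism : exists Phi : {rmorphism polyring K m -> {poly {poly L}}},
  (forall p, (Phi p)`_0 = (psi p)%:P) /\
  (forall i, (1 <= i <= m)%N -> Phi (x i) = curve i.-1).
Proof.
pose u : {rmorphism L -> {poly {poly L}}} := polyC \o polyC.
pose ev : {rmorphism {poly {poly L}} -> {poly L}} := horner_eval 0.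
have [i hi|Phi [Phiv Phip]] := @polyring_lift K L _ _ m psi u ev curve.
  rewrite /= /horner_eval hornerC /curve.
  have -> : var K m i = x i.+1 by [].
  case: ifP => h1; first by rewrite hornerM hornerXn expr0n mul0r psi_l ?polyC0 //; lia.
  case: ifP => h2; first by rewrite hornerM hornerX mul0r psi_l ?polyC0 //; lia.
  by rewrite hornerC.
exists Phi; split=> [p|i hi].
  by have := Phip p; rewrite /= /horner_eval !horner_coef0 coefC.
by rewrite -Phiv //; lia.
Qed.

Variable Phi : {rmorphism polyring K m -> {poly {poly L}}}.
Hypothesis Phi0 : forall p, (Phi p)`_0 = (psi p)%:P.
Hypothesis Phix : forall i, (1 <= i <= m)%N -> Phi (x i) = curve i.-1.

Lemma lead_x2 i : (1 <= i <= s)%N -> lead Phi 2 (x i) 'X^(curve_exp i).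
Proof.
move=> hi; exists ('X^(curve_exp i))%:P; rewrite coefC eqxx Phix; last lia.
have hi1 : i.-1.+1 = i by lia.
by rewrite /curve hi1; case: ifP => //; lia.
Qed.

Lemma lead_x1 i : (s < i <= l)%N -> lead Phi 1 (x i) 'X^(curve_exp i).
Proof.
move=> hi; exists ('X^(curve_exp i))%:P; rewrite coefC eqxx Phix; last lia.
have hi1 : i.-1.+1 = i by lia.
by rewrite /curve hi1; case: ifP; [lia|case: ifP => //; lia].
Qed.

(** In the first [s] rows [x i] alone has order 2; in the later rows both indices lie between
    [s + 1] and [l], and each factor has order 1. *)
Lemma lead_entry i j : (1 <= i <= n)%N -> (i <= j <= lam i)%N ->
  exists a, lead Phi 2 (x i * x j) a.
Proof.
move=> hi hj; have [his|his] := leqP i s.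
  by rewrite mulrC; eexists; apply: (leadZ Phi0); apply: lead_x2; lia.
have hl : (lam i <= l)%N by apply: lam_le_l; lia.
by eexists; apply: (@leadM _ _ _ 1 1); apply: lead_x1; lia.
Qed.

Lemma lead_ideal f : I f -> exists a, lead Phi 2 f a.
Proof.
move: f; apply: ideal_gen_min.
  split; first by exists 0; apply: lead0.
    by move=> f g [a ha] [b hb]; exists (a + b); apply: leadD.
  by move=> p f [a ha]; exists (psi p *: a); apply: leadZ.
by move=> _ [i [j [hi hj ->]]]; apply: lead_entry.
Qed.

Lemma lead_local_gen a : exists b, lead Phi 2 (local_gen a) b.
Proof.
rewrite /local_gen; case: ifP => [has|_].
  by eexists; apply: lead_x2; lia.
by apply: lead_ideal; apply: ferrers_diag_mem.
Qed.

Lemma curve_exp_i0 : curve_exp i0 = 0%N.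
Proof. by rewrite /curve_exp eqxx. Qed.

(** For [i <= s], multiply [x i] by a variable of its row that is nonzero at the point. For [i > s],
    multiply by [x i0], whose row has length exactly [l] and whose exponent of [z] is 0. *)
Lemma curve_gen i : (1 <= i <= l)%N ->
  exists Y c, [/\ I Y, c != 0 & lead Phi 2 Y (c *: 'X^(curve_exp i))].
Proof.
move=> hi; have [his|his] := leqP i s.
  have [j [hj pj]] := @psi_s i (ltac:(lia)).
  exists (x j * x i), (psi (x j)); split=> //.
    by rewrite mulrC; apply: (ferrers_mem K lamS lam1 lamn); lia.
  by apply: (leadZ Phi0); apply: lead_x2; lia.
have sn : (s < n)%N by move: lE; case: ifP => //; lia.
have li0 : l = lam i0 by rewrite lE /i0 sn.
exists (x i0 * x i), 1; rewrite oner_neq0; split=> //.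
  by apply: (ferrers_mem K lamS lam1 lamn); rewrite -?li0 /i0 ?sn; lia.
have -> : 1 *: 'X^(curve_exp i) = 'X^(curve_exp i0) * 'X^(curve_exp i) :> {poly L}.
  by rewrite curve_exp_i0 expr0 mul1r scale1r.
by apply: (@leadM _ _ _ 1 1); apply: lead_x1; rewrite /i0 ?sn; lia.
Qed.

Lemma curve_gen0 : exists Y c, [/\ I Y, c != 0 & lead Phi 2 Y (c *: 1)].
Proof.
have := @curve_gen i0; rewrite curve_exp_i0 expr0; apply.
by rewrite /i0; case: ifP; lia.
Qed.

Lemma curve_genN d : (d < l.-1)%N ->
  exists Y c, [/\ I Y, c != 0 & lead Phi 2 Y (c *: 'X^(N ^ d))].
Proof.
(* The exponent [N ^ d] is carried by index [d + 1] before [i0] and by [d + 2] after it, since [i0]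
   is skipped. *)
move=> hd; have [hdi|hdi] := ltnP d.+1 i0.
  have := @curve_gen d.+1; rewrite /curve_exp hdi (ltn_eqF hdi) /=; apply; lia.
have := @curve_gen d.+2.
have -> : curve_exp d.+2 = (N ^ d)%N.
  by rewrite /curve_exp; have -> : (d.+2 == i0) = false; [lia|have -> : (d.+2 < i0)%N = false by lia].
by apply; lia.
Qed.

End Curve.

Lemma reduction_locally_eq (J' : polyring K m -> Prop) r :
    is_ideal J' -> ideal_sub J' J ->
    ideal_sub (ideal_pow I r.+1) (ideal_mul J' (ideal_pow I r)) ->
  exists b, psi b != 0 /\ forall f, J f -> J' (b * f).
Proof.
move=> idJ' sJ' red.
(* Values at the point of the coefficient vectors of elements of [J']; these vectors are not unique,
   so all of them are taken. *)
pose W (w : 'rV[L]_l) := exists p : 'I_l -> polyring K m,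
  J' (\sum_a p a * local_gen a) /\ w = \row_a psi (p a).
have [[A [hA]]|[c [H [cl hH]]]] := free_rows_or_submx W l.
  rewrite row_free_unit unitmxE unitfE => detA.
  have /choice[p hp] : forall i, exists p : 'I_l -> polyring K m,
    J' (\sum_a p a * local_gen a) /\ row i A = \row_a psi (p a) by exact: hA.
  pose M := \matrix_(i, a) p i a.
  (* [M] lifts the invertible matrix [A], so its determinant survives under [psi], and the adjugate
     expresses each multiple of a local generator by it through elements of [J']. *)
  exists (\det M); split.
    rewrite -det_map_mx (_ : map_mx psi M = A) //; apply/matrixP => i a.
    by have [_ /rowP/(_ a)] := hp i; rewrite !mxE.
  have hgen a : J' (\det M * local_gen a).
    pose G := \col_a local_gen a.
    have : (\adj M *m (M *m G)) a 0 = \det M * local_gen a.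
      by rewrite mulmxA mul_adj_mx mul_scalar_mx !mxE.
    move=> <-; rewrite mxE; apply: is_ideal_sum => // i _.
    case: (idJ') => _ _; apply; have [hJ _] := hp i.
    rewrite mxE (eq_bigr (fun a => p i a * local_gen a)) // => b _.
    by rewrite !mxE.
  move=> f /diag_local_gen[u ->]; rewrite mulr_sumr; apply: is_ideal_sum => // a _.
  by rewrite mulrCA; case: (idJ') => _ _; apply.
exfalso.
pose T := ('I_n.+1 * 'I_m.+1)%type.
set C := (#|{: T}| ^ r)%N.
(* Just beyond the bound of [growth_bound] for [q = l - 1]. *)
pose N := (C * l.-1.+2 ^ l.-1).+1.
have [Phi [Phi0 Phix]] := curve_morphism N.
(* The rows of [H] applied to the leading coefficients of the local generators: fewer than [l] forms
   spanning those of [J']. *)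
pose h (b : 'I_c) : {poly L} := \sum_a H b a *: (Phi (local_gen a))`_2.
pose hs := [seq h b | b : 'I_c].
have lead_J' e : J' e -> exists2 a, inspan hs a & lead Phi 2 e a.
  move=> he; have [p ep] := diag_local_gen (sJ' _ he).
  exists (\sum_a psi (p a) *: (Phi (local_gen a))`_2); last first.
    rewrite ep; apply: lead_sum => a _; apply: (leadZ Phi0).
    by have [b hb] := lead_local_gen Phi0 Phix a; rewrite -(lead_eq_coef hb).
  have /submxP[u hu] : (\row_a psi (p a) <= H)%MS by apply: hH; exists p; rewrite -ep.
  have -> : \sum_a psi (p a) *: (Phi (local_gen a))`_2 = \sum_b u 0 b *: h b.
    rewrite /h; under [RHS]eq_bigr do rewrite scaler_sumr.
    rewrite exchange_big /=; apply: eq_bigr => a _.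
    have /rowP/(_ a) := hu; rewrite !mxE => ->; rewrite scaler_suml.
    by apply: eq_bigr => b _; rewrite scalerA.
  apply: big_ind; [exact: inspan0|exact: inspanD|].
  move=> b _; apply/inspanZ/mem_inspan; apply/mapP; exists b => //.
  by rewrite mem_enum.
have lead_g (ij : T) : exists a, lead Phi 2 (@ferrers_entry K n m lam ij) a.
  case: ij => i j; rewrite /ferrers_entry /=; case: ifP => [/and3P[i1 ij hj]|_].
    by apply: (lead_entry Phi0 Phix); have := ltn_ord i; lia.
  by exists 0; apply: lead0.
have hgr := @fiber_growth _ _ psi Phi Phi0 T _ _ (ferrers_entry_surj lamS lam1 lamn) lead_g
  J' hs r lead_J' red l.-1 N (ltn0Sn _) (curve_gen0 Phi0 Phix) (curve_genN Phi0 Phix).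
have szhs : (size hs <= l.-1)%N by rewrite size_map -cardE card_ord; lia.
by have := growth_bound (ltn0Sn _) szhs hgr; rewrite -/C /N; lia.
Qed.

End FerrersMinimal.

(* lam i = lambda_i for 1 <= i <= n (values outside are irrelevant). *)
Theorem theorem5p2 (K : fieldType) (n m : nat) (lam : nat -> nat) :
  (0 < n)%N ->
  (forall i : nat, (1 <= i)%N -> (i < n)%N -> (lam i.+1 <= lam i)%N) ->
  lam 1%N = m ->
  (n <= lam n)%N ->
  is_minimal_reduction (ferrers_diag_ideal K m n lam) (ferrers_spec K m n lam).
Proof.
move=> n0 lamS lam1 lamn; split; first exact: ferrers_reduction.
move=> J' idJ' sJ' nsJ [_ _ [r hr]]; apply: nsJ.
set J := ferrers_diag_ideal K m n lam in sJ' *.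
set I := ferrers_spec K m n lam in hr.
(* The colon ideal [J' : J]; it contains 1 exactly when [J] is inside [J']. *)
pose Q a := forall f, J f -> J' (a * f).
have [J0 JD JM] := idJ'.
have idQ : is_ideal Q.
  split=> [f _|a b ha hb f hf|u a ha f hf]; first by rewrite mul0r.
    by rewrite mulrDl; apply: JD; [apply: ha|apply: hb].
  by rewrite -mulrA; apply/JM/ha.
have [Q1|Q1] := pselect (Q 1); first by move=> f /Q1; rewrite mul1r.
have [L [psi psiQ]] := residue_field_exists idQ Q1.
have red : ideal_sub (ideal_pow I r.+1) (ideal_mul J' (ideal_pow I r)) by move=> f /hr.
have psi0 i : (1 <= i <= n)%N -> psi (xvar K m i) = 0.
  move=> hi; have hii : I (xvar K m i * xvar K m i).
    by apply: ferrers_mem => //; have := lam_le lamS lam1 lamn (i := i); lia.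
  (* A power of the square of [x_i] lies in [I^(r+1)], hence in [J'] and in [Q], so [psi] kills
     [x_i]. *)
  have /red/(ideal_mul_subl idJ') hJ' : ideal_pow I r.+1 ((xvar K m i * xvar K m i) ^+ r.+1).
    by rewrite -[X in ideal_pow I X]muln1; apply/ideal_powX/ideal_pow1.
  have /psiQ : Q ((xvar K m i * xvar K m i) ^+ r.+1).
    by move=> f _; rewrite mulrC; apply: JM.
  by move=> /eqP; rewrite rmorphXn rmorphM expf_eq0 /= mulf_eq0 orbb => /eqP.
have [s [l [sn nl lE psil psis]]] := ferrers_split_index n0 lamS lam1 lamn psi0.
have [b [pb hb]] := reduction_locally_eq n0 lamS lam1 lamn sn nl lE psil psis idJ' sJ' red.
by rewrite psiQ ?eqxx in pb.
Qed.
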